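(* Let $(\mathfrak{g},[\cdot,\cdot]_\mathfrak{g},N)$ be a Nijenhuis Lie algebra. Then the set of all equivalence classes of infinitesimal deformations of $(\mathfrak{g},[\cdot,\cdot]_\mathfrak{g},N)$ has a bijection with the second cohomology group $H^2_{\mathrm{NLie}}(\mathfrak{g},N)$.
   Context: All vector spaces are over a fixed field $\mathbf{k}$. A Nijenhuis Lie algebra $(\mathfrak{g},[\cdot,\cdot]_\mathfrak{g},N)$ is a Lie algebra with a linear map $N$ satisfying $[N(x),N(y)]_\mathfrak{g}=N\big([N(x),y]_\mathfrak{g}+[x,N(y)]_\mathfrak{g}-N[x,y]_\mathfrak{g}\big)$; the same definition is used for modules over a commutative ring $\mathsf{R}$, with all maps (bi)linear over $\mathsf{R}$. Homomorphisms are Lie algebra homomorphisms commuting with the Nijenhuis operators. Let $\mathsf{R}=\mathbf{k}[[t]]/(t^2)$ with augmentation $\varepsilon:\mathsf{R}\to\mathbf{k}$, $\varepsilon(a+bt)=a$. $\mathfrak{g}$ is regarded as an $\mathsf{R}$-module via $\varepsilon$. An infinitesimal deformation of $(\mathfrak{g},[\cdot,\cdot]_\mathfrak{g},N)$ is a pair $(\mu_\mathsf{R},N_\mathsf{R})$ of an antisymmetric $\mathsf{R}$-bilinear map $\mu_\mathsf{R}$ on $\mathsf{R}\otimes_\mathbf{k}\mathfrak{g}$ and an $\mathsf{R}$-linear map $N_\mathsf{R}:\mathsf{R}\otimes_\mathbf{k}\mathfrak{g}\to\mathsf{R}\otimes_\mathbf{k}\mathfrak{g}$ such that $(\mathsf{R}\otimes_\mathbf{k}\mathfrak{g},\mu_\mathsf{R},N_\mathsf{R})$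 is a Nijenhuis Lie algebra over $\mathsf{R}$ and $\varepsilon\otimes\mathrm{Id}_\mathfrak{g}:\mathsf{R}\otimes_\mathbf{k}\mathfrak{g}\to\mathfrak{g}$ is a morphism of Nijenhuis Lie algebras (over $\mathsf{R}$) to $(\mathfrak{g},[\cdot,\cdot]_\mathfrak{g},N)$. Equivalently, $\mu_\mathsf{R}=[\cdot,\cdot]_\mathfrak{g}+t\mu_1$ and $N_\mathsf{R}=N+tN_1$ with $\mu_1$ antisymmetric bilinear and $N_1$ linear on $\mathfrak{g}$. Two infinitesimal deformations $(\mu_\mathsf{R},N_\mathsf{R})$, $(\mu'_\mathsf{R},N'_\mathsf{R})$ are equivalent if there is an $\mathsf{R}$-linear isomorphism $\varphi$ of $\mathsf{R}\otimes_\mathbf{k}\mathfrak{g}$ which is a morphism of Nijenhuis Lie algebras from the first to the second and satisfies $(\varepsilon\otimes\mathrm{Id}_\mathfrak{g})\circ\varphi=\varepsilon\otimes\mathrm{Id}_\mathfrak{g}$. The cohomology $H^\bullet_{\mathrm{NLie}}(\mathfrak{g},N)$ (adjoint coefficients) is that of the complex $C^0=0$, $C^1=\mathrm{Hom}(\mathfrak{g},\mathfrak{g})$, $C^n=\mathrm{Hom}(\wedge^n\mathfrak{g},\mathfrak{g})\oplus\mathrm{Hom}(\wedge^{n-1}\mathfrak{g},\mathfrak{g})$ for $n\ge2$, with $\delta_{\mathrm{NLie}}(f)=(\delta_{\mathrm{CE}}f,-\partial^Nf)$ on $C^1$ and $\delta_{\mathrm{NLie}}(\chi,F)=(\delta_{\mathrm{CE}}\chi,d_NF+(-1)^n\partial^N\chi)$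 on $C^n$, $n\ge2$, where $(\delta_{\mathrm{CE}}f)(x_1,\dots,x_{n+1})=\sum_i(-1)^{i+1}[x_i,f(\dots,\widehat{x_i},\dots)]_\mathfrak{g}+\sum_{i<j}(-1)^{i+j}f([x_i,x_j]_\mathfrak{g},\dots,\widehat{x_i},\dots,\widehat{x_j},\dots)$; $(d_Nf)(x_1,\dots,x_{n+1})=\sum_i(-1)^{i+1}[N(x_i),f(\dots,\widehat{x_i},\dots)]_\mathfrak{g}+\sum_{i<j}(-1)^{i+j}f([N(x_i),x_j]_\mathfrak{g}+[x_i,N(x_j)]_\mathfrak{g}-N[x_i,x_j]_\mathfrak{g},\dots,\widehat{x_i},\dots,\widehat{x_j},\dots)-N((\delta_{\mathrm{CE}}f)(x_1,\dots,x_{n+1}))$; $(\partial^Nf)(x_1,\dots,x_n)=\sum_{k=0}^n(-1)^kN^k\big(\sum_{|I|=k}f(y^I_1,\dots,y^I_n)\big)$ with $I\subseteq\{1,\dots,n\}$, $y^I_i=x_i$ if $i\in I$ and $y^I_i=N(x_i)$ otherwise. *)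

(* Defs.v *)
From HB Require Import structures.
From mathcomp Require Import all_boot all_order all_algebra.
From mathcomp Require Import boolp classical_sets functions.

Set Implicit Arguments.
Unset Strict Implicit.
Unset Printing Implicit Defensive.

Import GRing.Theory.

Local Open Scope ring_scope.
Local Open Scope classical_set_scope.

(* A Lie bracket is alternating, which implies antisymmetry in every
   characteristic; accordingly Hom(/\^n g, g) is the space of alternating
   multilinear maps, see [alternating_multilinear]. *)
Record nijenhuis_lie (R : comNzRingType) (L : lmodType R)
    (br : L -> L -> L) (N : L -> L) : Prop := NijenhuisLie {
  nlie_linearl : forall y, linear (br^~ y);
  nlie_linearr : forall x, linear (br x);
  nlie_alternating : forall x, br x x = 0;
  nlie_jacobi : forall x y z,
    br x (br y z) + br y (br z x) + br z (br x y) = 0;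
  nlie_linear : linear N;
  nlie_nijenhuis : forall x y,
    br (N x) (N y) = N (br (N x) y + br x (N y) - N (br x y))
}.

Definition nlie_hom (R : comNzRingType) (L M : lmodType R)
    (brL : L -> L -> L) (NL : L -> L) (brM : M -> M -> M) (NM : M -> M)
    (f : L -> M) : Prop :=
  [/\ linear f, {morph f : x y / brL x y >-> brM x y}
    & {morph f : x / NL x >-> NM x}].

Lemma nlie_antisymmetric (R : comNzRingType) (L : lmodType R)
    (br : L -> L -> L) (N : L -> L) :
  nijenhuis_lie br N -> forall x y, br x y = - br y x.
Proof.
move=> h x y.
have D z u v : br z (u + v) = br z u + br z v.
  by have := nlie_linearr h z 1 u v; rewrite !scale1r.
have D' z u v : br (u + v) z = br u z + br v z.
  by have := nlie_linearl h z 1 u v; rewrite !scale1r.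
have := nlie_alternating h (x + y).
rewrite D !D' !(nlie_alternating h) add0r addr0 => /eqP.
by rewrite addrC addr_eq0 => /eqP.
Qed.

(* k[[t]]/(t^2) = k[t]/(t^2); 'qX is the class of t, and a`_0 and a`_1 are the
   coefficients of a = a`_0 + a`_1 t. *)
Notation dual k := {poly %/ ('X^2 : {poly k})}.

Section DualNumbers.
Variable k : fieldType.
Implicit Types a b : dual k.

Definition aug a : k := a`_0.

Lemma coef_in_dual (p : {poly k}) i : (i < 2)%N ->
  (in_qpoly 'X^2 p : {poly k})`_i = p`_i.
Proof.
move=> i_lt2; rewrite /= mk_monic_Xn -Pdiv.RingMonic.take_poly_rmodp.
by rewrite coef_take_poly i_lt2.
Qed.

Lemma coef0_dualM a b : (a * b)`_0 = a`_0 * b`_0.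
Proof. by rewrite [LHS]coef_in_dual // coef0M. Qed.

Lemma coef1_dualM a b : (a * b)`_1 = a`_0 * b`_1 + a`_1 * b`_0.
Proof. by rewrite [LHS]coef_in_dual // coefM !big_ord_recl big_ord0 addr0. Qed.

Lemma coef_dual1 i : (1 : dual k)`_i = (i == 0%N)%:R.
Proof. by rewrite [LHS]coefC; case: i. Qed.

Lemma dualP a b : a`_0 = b`_0 -> a`_1 = b`_1 -> a = b.
Proof.
move=> e0 e1; apply/npolyP => -[|[|i]] //.
by rewrite !big_coef_npoly // mk_monic_Xn size_polyXn.
Qed.

End DualNumbers.

(* [baseChange g] is k[[t]]/(t^2) (x)_k g, the pair (x, y) standing for
   1 (x) x + t (x) y. The lemmas [tensor_lift] and [tensor_ext] give its
   universal property. *)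
Definition baseChange (k : fieldType) (g : lmodType k) : Type := (g * g)%type.

HB.instance Definition _ (k : fieldType) (g : lmodType k) :=
  GRing.Zmodule.copy (baseChange g) (g * g)%type.

Section BaseChange.
Variables (k : fieldType) (g : lmodType k).
Implicit Types (a b : dual k) (u v : baseChange g).

Definition bc_scale a u : baseChange g :=
  (a`_0 *: u.1, a`_0 *: u.2 + a`_1 *: u.1).

Fact bc_scaleA a b u : bc_scale a (bc_scale b u) = bc_scale (a * b) u.
Proof.
congr pair; rewrite /= ?coef0_dualM ?coef1_dualM ?scalerA //.
by rewrite scalerDr !scalerA scalerDl addrA.
Qed.

Fact bc_scale1 : left_id 1 bc_scale.
Proof.
by case=> x y; rewrite /bc_scale !coef_dual1 /= !scale1r scale0r addr0.
Qed.

Fact bc_scaleDr : right_distributive bc_scale +%R.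
Proof.
by move=> a u v; congr pair; rewrite /= !scalerDr // addrACA.
Qed.

Fact bc_scaleDl u : {morph bc_scale^~ u : a b / a + b}.
Proof.
move=> a b; rewrite /bc_scale !coefD; congr pair; rewrite /= !scalerDl //.
by rewrite addrACA.
Qed.

HB.instance Definition _ := GRing.Zmodule_isLmodule.Build (dual k)
  (baseChange g) bc_scaleA bc_scale1 bc_scaleDr bc_scaleDl.

Definition tensor a (x : g) : baseChange g := (a`_0 *: x, a`_1 *: x).

Definition aug_id u : g := u.1.

Lemma aug_id_tensor a x : aug_id (tensor a x) = aug a *: x.
Proof. by []. Qed.

Lemma scale_tensor a b x : a *: tensor b x = tensor (a * b) x.
Proof.
rewrite [LHS]/GRing.scale /= /bc_scale /tensor coef0_dualM coef1_dualM /=.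
by rewrite !scalerA scalerDl.
Qed.

Lemma tensor_decomp u : u = tensor 1 u.1 + tensor 'qX u.2.
Proof.
case: u => x y; rewrite /tensor !coef_dual1 !coef_in_dual // !coefX /=.
by congr pair; rewrite /= ?scale1r ?scale0r ?addr0 ?add0r.
Qed.

Lemma tensor_linearl x c a b : tensor (c *: a + b) x =
  (c *: (1 : dual k)) *: tensor a x + tensor b x.
Proof.
rewrite scale_tensor -scalerAl mul1r /tensor !coefD !coefZ.
by congr pair; rewrite /= scalerDl.
Qed.

Lemma tensor_linearr a c x y : tensor a (c *: x + y) =
  (c *: (1 : dual k)) *: tensor a x + tensor a y.
Proof.
rewrite scale_tensor -scalerAl mul1r /tensor !coefZ.
by congr pair; rewrite /= scalerDr scalerA mulrC.
Qed.

Lemma tensor_lift (W : lmodType k) (b : dual k -> g -> W) :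
    (forall x, linear (b^~ x)) -> (forall a, linear (b a)) ->
  exists F : baseChange g -> W,
    [/\ {morph F : u v / u + v},
        forall c u, F ((c *: (1 : dual k)) *: u) = c *: F u
      & forall a x, F (tensor a x) = b a x].
Proof.
move=> bl br.
have blD a a' x : b (a + a') x = b a x + b a' x.
  by have := bl x 1 a a'; rewrite !scale1r.
have b0l x : b 0 x = 0 by apply: (addrI (b 0 x)); rewrite -blD !addr0.
have blZ c a x : b (c *: a) x = c *: b a x.
  by have := bl x c a 0; rewrite !addr0 b0l addr0.
have brD a x y : b a (x + y) = b a x + b a y.
  by have := br a 1 x y; rewrite !scale1r.
have b0r a : b a 0 = 0 by apply: (addrI (b a 0)); rewrite -brD !addr0.
have brZ c a x : b a (c *: x) = c *: b a x.
  by have := br a c x 0; rewrite !addr0 b0r addr0.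
exists (fun u => b 1 u.1 + b 'qX u.2); split=> [u v|c u|a x].
- by rewrite /= !brD addrACA.
- rewrite [_ *: u]/GRing.scale /= /bc_scale !coefZ !coef_dual1 /=.
  by rewrite mulr1 mulr0 scale0r addr0 !brZ scalerDr.
- rewrite /tensor /= !brZ -!blZ -blD; congr (b _ x).
  apply: dualP; rewrite coefD !coefZ !coef_dual1 !coef_in_dual // !coefX /=.
    by rewrite mulr1 mulr0 addr0.
  by rewrite mulr1 mulr0 add0r.
Qed.

Lemma tensor_ext (W : lmodType k) (F G : baseChange g -> W) :
    {morph F : u v / u + v} -> {morph G : u v / u + v} ->
  (forall a x, F (tensor a x) = G (tensor a x)) -> F =1 G.
Proof. by move=> FD GD e u; rewrite (tensor_decomp u) FD GD !e. Qed.

End BaseChange.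

(* [augModule g] is g regarded as a module over k[[t]]/(t^2) via [aug]. *)
Definition augModule (k : fieldType) (g : lmodType k) : Type := g.

HB.instance Definition _ (k : fieldType) (g : lmodType k) :=
  GRing.Zmodule.copy (augModule g) g.

Section AugModule.
Variables (k : fieldType) (g : lmodType k).

Definition aug_scale (a : dual k) (x : augModule g) : augModule g :=
  aug a *: (x : g).

Fact aug_scaleA a b x : aug_scale a (aug_scale b x) = aug_scale (a * b) x.
Proof. by rewrite /aug_scale scalerA /aug coef0_dualM. Qed.

Fact aug_scale1 : left_id 1 aug_scale.
Proof. by move=> x; rewrite /aug_scale /aug coef_dual1 scale1r. Qed.

Fact aug_scaleDr : right_distributive aug_scale +%R.
Proof. by move=> a x y; rewrite /aug_scale scalerDr. Qed.

Fact aug_scaleDl x : {morph aug_scale^~ x : a b / a + b}.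
Proof. by move=> a b; rewrite /aug_scale /aug coefD scalerDl. Qed.

HB.instance Definition _ := GRing.Zmodule_isLmodule.Build (dual k)
  (augModule g) aug_scaleA aug_scale1 aug_scaleDr aug_scaleDl.

End AugModule.

Definition rel_classes (T : Type) (A : set T) (r : T -> T -> Prop) :
    set (set T) :=
  [set [set y | A y /\ r x y] | x in A].

Section Deformations.
Variables (k : fieldType) (g : lmodType k) (br : g -> g -> g) (N : g -> g).

Definition deformation_data : Type :=
  ((baseChange g -> baseChange g -> baseChange g) *
   (baseChange g -> baseChange g))%type.

Definition inf_deformation : set deformation_data :=
  [set D | nijenhuis_lie D.1 D.2 /\
    nlie_hom (M := augModule g) D.1 D.2 br N (@aug_id k g)].

Definition equiv_deformation (D D' : deformation_data) : Prop :=
  exists phi : baseChange g -> baseChange g,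
    [/\ bijective phi, nlie_hom D.1 D.2 D'.1 D'.2 phi
      & forall u, aug_id (phi u) = aug_id u].

Definition deformation_classes : set (set deformation_data) :=
  rel_classes inf_deformation equiv_deformation.

End Deformations.

Arguments deformation_data {k} g.

Section Cohomology.
Variables (k : fieldType) (g : lmodType k) (br : g -> g -> g) (N : g -> g).

Definition nary_map (n : nat) : Type := {ffun 'I_n -> g} -> g.

HB.instance Definition _ n := GRing.Lmodule.copy (nary_map n)
  ({ffun 'I_n -> g} -> g).

Definition alternating_multilinear n (f : nary_map n) : Prop :=
  (forall (x : {ffun 'I_n -> g}) i,
     linear (fun u => f [ffun l => if l == i then u else x l])) /\
  (forall (x : {ffun 'I_n -> g}) i j, i != j -> x i = x j -> f x = 0).

Definition args n (s : seq g) : {ffun 'I_n -> g} := [ffun i : 'I_n => s`_i].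

Definition omit n (x : {ffun 'I_n -> g}) (s : seq 'I_n) : seq g :=
  [seq x l | l <- enum 'I_n & l \notin s].

(* With indices starting from 1 the signs would be (-1)^(i+1) and (-1)^(i+j). *)
Definition ce_diff (act lie : g -> g -> g) n (f : nary_map n) : nary_map n.+1 :=
  fun x =>
    \sum_(i < n.+1) (-1) ^+ i *: act (x i) (f (args n (omit x [:: i])))
    + \sum_(i < n.+1) \sum_(j < n.+1 | (i < j)%N)
        (-1) ^+ (i + j) *:
          f (args n (lie (x i) (x j) :: omit x [:: i; j])).

Definition dCE n (f : nary_map n) : nary_map n.+1 := ce_diff br br f.

Definition brN (x y : g) : g := br (N x) y + br x (N y) - N (br x y).

Definition dN n (f : nary_map n) : nary_map n.+1 :=
  fun x => ce_diff (fun u v => br (N u) v) brN f x - N (dCE f x).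

Definition partialN n (f : nary_map n) : nary_map n :=
  fun x => \sum_(m < n.+1) (-1) ^+ m *:
    iter m N (\sum_(I : {set 'I_n} | #|I| == m)
      f [ffun i => if i \in I then x i else N (x i)]).

(* The ambient space of C^n, without the condition that the components are
   alternating and multilinear; 'rV_0 is the zero space. *)
Definition precochain (n : nat) : lmodType k :=
  match n with
  | 0 => 'rV[k]_0
  | 1 => nary_map 1
  | m.+2 => (nary_map m.+2 * nary_map m.+1)%type
  end.

Definition cochain (n : nat) : set (precochain n) :=
  match n return set (precochain n) with
  | 0 => setT
  | 1 => [set f | alternating_multilinear f]
  | m.+2 => [set c | alternating_multilinear c.1 /\
                     alternating_multilinear c.2]
  end.

Definition dNLie (n : nat) : precochain n -> precochain n.+1 :=
  match n return precochain n -> precochain n.+1 with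
  | 0 => fun=> 0
  | 1 => fun f => (dCE f, - partialN f)
  | m.+2 => fun c =>
      (dCE c.1, dN c.2 + (-1) ^+ m.+2 *: partialN c.1)
  end.

Definition cocycle (n : nat) : set (precochain n) :=
  [set c | cochain c /\ dNLie c = 0].

Definition coboundary (n : nat) : set (precochain n) :=
  match n return set (precochain n) with
  | 0 => [set 0]
  | m.+1 => [set dNLie c | c in @cochain m]
  end.

(* H^n, as the set of cosets of the coboundaries in the cocycles. *)
Definition cohomology (n : nat) : set (set (precochain n)) :=
  rel_classes (@cocycle n) (fun c c' => coboundary (c - c')).

End Cohomology.

Arguments nary_map {k} g n.
Arguments precochain {k} g n.
Arguments cochain {k} g n.
Arguments dNLie {k g} br N n c.
Arguments cocycle {k g} br N n.
Arguments coboundary {k g} br N n.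
Arguments cohomology {k g} br N n.

(* Main.v *)
Require Import Defs.
From mathcomp Require Import all_boot all_order all_algebra.
From mathcomp Require Import boolp classical_sets functions.

(** Modulo t^2 everything about a deformation is contained in its coefficient
    of t.  An R-linear map f of R (x) g that lifts a linear map M of g along the
    augmentation is forced to be (x, y) |-> (M x, M y + F x), and an R-bilinear
    lift of the bracket is forced to be
    ((x, y), (x', y')) |-> ([x, x'], [x, y'] + [y, x'] + chi x x'):
    since t kills the submodule t g, the values on pairs (x, 0) determine the
    rest ([ext_mapE], [ext_brE]).  So a deformation is the same thing as a pair
    (chi, F), where chi is bilinear and alternating and F is linear, subject to
    the coefficient of t in the Jacobi and Nijenhuis identities.

    Expanding the cochain complex in degree 2, the coefficient of t in the
    Jacobi identity is dCE chi = 0 ([ext_br_jacobiP], [dCE_eq0P]), and the one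
    in the Nijenhuis identity is dN F + partialN chi = 0 ([ext_nijenhuisP],
    [dN_partialN_eq0P]).  The terms that involve the t-parts of the arguments
    cancel, because they are instances of the identities of g.  Hence taking the
    coefficient of t is a bijection from deformations to 2-cocycles
    ([first_order_bij]).

    An equivalence of deformations lifts the identity of g, so it has the form
    (x, y) |-> (x, y + psi x), and it is invertible for every psi.  That it
    respects the brackets and the operators says precisely that the difference
    of the two cocycles is (dCE psi, - partialN psi) ([equiv_extensionP]).  The
    bijection therefore matches the two relations, and taking images of
    classes under it gives the bijection of the theorem ([rel_classes_bij]). *)

Set Implicit Arguments.
Unset Strict Implicit.
Unset Printing Implicit Defensive.
Import GRing.Theory.
Local Open Scope ring_scope.
Local Open Scope classical_set_scope.

(** * Classes of a relation and linear maps *)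

(** The image under [h] of the class of x is the class of h x, and taking
    images under [h] is injective on the subsets of [A]. *)
Lemma rel_classes_bij (S T : Type) (A : set S) (B : set T)
    (r : S -> S -> Prop) (s : T -> T -> Prop) (h : S -> T) :
    set_bij A B h ->
    (forall x y, A x -> A y -> r x y <-> s (h x) (h y)) ->
  set_bij (rel_classes A r) (rel_classes B s) (image^~ h).
Proof.
case=> hAB hinj hsurj rs.
have imE x : A x ->
    h @` [set y | A y /\ r x y] = [set y | B y /\ s (h x) y].
  move=> Ax; apply/seteqP; split=> [_ [y [Ay rxy] <-]|z [Bz sxz]] /=.
    by split; [exact: hAB | apply/rs].
  have [y Ay hy] := hsurj z Bz; exists y => //; split=> //.
  by apply/rs => //; rewrite hy.
have sub C C' : rel_classes A r C -> rel_classes A r C' ->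
    h @` C = h @` C' -> C `<=` C'.
  move=> [x Ax <-] [x' Ax' <-] e y [Ay rxy].
  have [y' y'C' hy] : (h @` [set y | A y /\ r x' y]) (h y).
    by rewrite -e; exists y.
  by rewrite -(hinj y' y) // inE //; case: y'C'.
split=> [_ [x Ax <-]|C C' /set_mem rC /set_mem rC' e|_ [z Bz <-]].
- by rewrite imE //; exists (h x) => //; exact: hAB.
- by apply/seteqP; split; apply: sub.
- have [x Ax <-] := hsurj z Bz.
  by exists [set y | A y /\ r x y]; [exists x | rewrite imE].
Qed.

(** The axioms of [nijenhuis_lie] say [linear] of bare functions, which have no
    structure for the generic lemmas on linear maps to apply to. *)
Section LinearFacts.
Variables (R : pzRingType) (U V : lmodType R) (f : U -> V).
Hypothesis f_lin : linear f.

Lemma linD x y : f (x + y) = f x + f y.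
Proof. by have := f_lin 1 x y; rewrite !scale1r. Qed.

Lemma lin0 : f 0 = 0.
Proof. by apply: (addrI (f 0)); rewrite -linD !addr0. Qed.

Lemma linZ c x : f (c *: x) = c *: f x.
Proof. by have := f_lin c x 0; rewrite !addr0 lin0 addr0. Qed.

Lemma linN x : f (- x) = - f x.
Proof. by rewrite -scaleN1r linZ scaleN1r. Qed.

End LinearFacts.

(** * Cochains of low degree as functions of one, two or three arguments *)

Section LowDegree.
Variables (k : fieldType) (g : lmodType k).

Definition ev1 (f : nary_map g 1) x := f (args 1 [:: x]).
Definition ev2 (f : nary_map g 2) x y := f (args 2 [:: x; y]).
Definition ev3 (f : nary_map g 3) x y z := f (args 3 [:: x; y; z]).

Lemma args1E (x : {ffun 'I_1 -> g}) : args 1 [:: x 0] = x.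
Proof. by apply/ffunP => i; rewrite ffunE ord1. Qed.

Lemma args2E (x : {ffun 'I_2 -> g}) : args 2 [:: x 0; x 1] = x.
Proof.
by apply/ffunP => -[[|[]]] // i; rewrite ffunE /=; congr (x _); apply: val_inj.
Qed.

Lemma args3E (x : {ffun 'I_3 -> g}) : args 3 [:: x 0; x 1; x ord_max] = x.
Proof.
by apply/ffunP => -[[|[|[]]]] // i; rewrite ffunE /=; congr (x _);
  apply: val_inj.
Qed.

Lemma ev1_inj (f f' : nary_map g 1) : ev1 f =1 ev1 f' -> f = f'.
Proof. by move=> e; apply/funext => x; rewrite -(args1E x); exact: e. Qed.

Lemma ev2_inj (f f' : nary_map g 2) : ev2 f =2 ev2 f' -> f = f'.
Proof. by move=> e; apply/funext => x; rewrite -(args2E x); exact: e. Qed.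

Lemma ev3_inj (f f' : nary_map g 3) :
  (forall x y z, ev3 f x y z = ev3 f' x y z) -> f = f'.
Proof. by move=> e; apply/funext => x; rewrite -(args3E x); exact: e. Qed.

(** For a concrete [n] the right-hand side reduces to an explicit list, while
    the enumeration of an ordinal type does not compute. *)
Lemma omit_args n (s : seq g) (t : seq 'I_n) :
  omit (args n s) t = [seq s`_i | i <- iota 0 n & i \notin map val t].
Proof.
rewrite -val_enum_ord filter_map -map_comp.
rewrite (eq_filter (a2 := [pred l : 'I_n | l \notin t])); last first.
  by move=> l /=; rewrite mem_map //; apply: val_inj.
by apply: eq_map => l; rewrite /= ffunE.
Qed.

Lemma ce_diffE act lie n (f : nary_map g n) x :
  ce_diff act lie f x =
    \sum_(i < n.+1) (-1) ^+ i *: act (x i) (f (args n (omit x [:: i])))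
    + \sum_(i < n.+1) \sum_(j < n.+1) if (i < j)%N then
        (-1) ^+ (i + j) *:
          f (args n (lie (x i) (x j) :: omit x [:: i; j])) else 0.
Proof. by congr (_ + _); apply: eq_bigr => i _; rewrite big_mkcond. Qed.

Lemma ce_diff1E act lie (f : nary_map g 1) x y :
  ev2 (ce_diff act lie f) x y =
    act x (ev1 f y) - act y (ev1 f x) - ev1 f (lie x y).
Proof.
rewrite /ev2 ce_diffE !big_ord_recl !big_ord0 /= !omit_args !ffunE /bump /=.
by rewrite expr1 expr0 !scaleN1r scale1r !(add0r, addr0).
Qed.

Lemma ce_diff2E act lie (f : nary_map g 2) x y z :
  ev3 (ce_diff act lie f) x y z =
    act x (ev2 f y z) - act y (ev2 f x z) + act z (ev2 f x y)
    - ev2 f (lie x y) z + ev2 f (lie x z) y - ev2 f (lie y z) x.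
Proof.
rewrite /ev3 ce_diffE !big_ord_recl !big_ord0 /= !omit_args !ffunE /bump /=.
rewrite -[(-1) ^+ (1 + 1)]signr_odd -[(-1) ^+ (0 + _)]signr_odd.
rewrite -[(-1) ^+ (1 + 0 + _)]signr_odd /=.
by rewrite expr1 expr0 !scaleN1r !scale1r !(add0r, addr0) !addrA.
Qed.

Lemma sum_set_card0 n (F : {set 'I_n} -> g) :
  \sum_(I : {set 'I_n} | #|I| == 0%N) F I = F finset.set0.
Proof. by rewrite (eq_bigl _ _ (@cards_eq0 _)) big_pred1_eq. Qed.

Lemma sum_set_cardT n (F : {set 'I_n} -> g) :
  \sum_(I : {set 'I_n} | #|I| == n) F I = F finset.setT.
Proof.
rewrite (eq_bigl (pred1 finset.setT)) ?big_pred1_eq // => I /=.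
rewrite eqEcard finset.subsetT cardsT card_ord eqn_leq.
by rewrite -[X in (_ <= X)%N](card_ord n) max_card.
Qed.

Lemma partialN1E N (f : nary_map g 1) x :
  ev1 (partialN N f) x = ev1 f (N x) - N (ev1 f x).
Proof.
rewrite /ev1 /partialN !big_ord_recl big_ord0 /bump /=.
rewrite sum_set_card0 sum_set_cardT expr0 expr1 scale1r scaleN1r addr0.
by congr (f _ - N (f _)); rewrite -[LHS]args1E !ffunE !inE.
Qed.

Lemma partialN2E N (f : nary_map g 2) x y :
  ev2 (partialN N f) x y =
   ev2 f (N x) (N y) - N (ev2 f x (N y) + ev2 f (N x) y) + N (N (ev2 f x y)).
Proof.
rewrite /ev2 /partialN !big_ord_recl big_ord0 /bump /=.
rewrite sum_set_card0 sum_set_cardT big_cards1 !big_ord_recl big_ord0.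
rewrite -[(-1) ^+ (1 + 1)]signr_odd expr0 expr1 !scale1r scaleN1r /=.
rewrite !addr0 addrA.
by congr (f _ - N (f _ + f _) + N (N (f _))); rewrite -[LHS]args2E !ffunE !inE.
Qed.

Lemma alternating1P (f : nary_map g 1) :
  alternating_multilinear f <-> linear (ev1 f).
Proof.
have subE (x : {ffun 'I_1 -> g}) i :
    (fun u => f [ffun l => if l == i then u else x l]) = ev1 f.
  by apply/funext => u; rewrite -[[ffun _ => _]]args1E ffunE !ord1.
split=> [[lin _]|lin]; first by rewrite -(subE 0 0); apply: lin.
by split=> [x i|x i j]; [rewrite subE | rewrite !ord1].
Qed.

Lemma alternating2P (f : nary_map g 2) :
  alternating_multilinear f <->
    [/\ forall y, linear (ev2 f^~ y), forall x, linear (ev2 f x)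
      & forall x, ev2 f x x = 0].
Proof.
have sub0 (x : {ffun 'I_2 -> g}) :
    (fun u => f [ffun l => if l == 0 then u else x l]) = ev2 f^~ (x 1).
  by apply/funext => u; rewrite -[[ffun _ => _]]args2E !ffunE.
have sub1 (x : {ffun 'I_2 -> g}) :
    (fun u => f [ffun l => if l == 1 then u else x l]) = ev2 f (x 0).
  by apply/funext => u; rewrite -[[ffun _ => _]]args2E !ffunE.
have ord2 (i : 'I_2) : i = 0 \/ i = 1.
  by case: i => [[|[]]] // i; [left | right]; apply: val_inj.
split=> [[lin alt]|[linl linr alt]].
- split=> [y|x|x].
  + by have := lin [ffun=> y] 0; rewrite sub0 ffunE.
  + by have := lin [ffun=> x] 1; rewrite sub1 ffunE.
  + by apply: (alt _ 0 1); rewrite // !ffunE.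
- split=> [x i|x i j].
  + by case: (ord2 i) => ->; rewrite ?sub0 ?sub1.
  + case: (ord2 i) (ord2 j) => -> [] -> // _ e.
      by rewrite -(args2E x) e; apply: alt.
    by rewrite -(args2E x) e; apply: alt.
Qed.

End LowDegree.

(** * Extensions of a bracket and of an operator to first order in t *)

Section Extension.
Variables (k : fieldType) (g : lmodType k) (br : g -> g -> g) (N : g -> g).
Hypothesis nlie : nijenhuis_lie br N.
Implicit Types (chi : g -> g -> g) (F psi : g -> g).

(** [br + t chi], expanded on pairs. *)
Definition ext_br chi (u v : baseChange g) : baseChange g :=
  (br u.1 v.1, br u.1 v.2 + br u.2 v.1 + chi u.1 v.1).
(** [M + t F]; the linear map [M] is the operator [N] for a deformation and the
    identity for an equivalence. *)
Definition ext_map (M : g -> g) F (u : baseChange g) : baseChange g :=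
  (M u.1, M u.2 + F u.1).

Let bcD (u v : baseChange g) : u + v = (u.1 + v.1, u.2 + v.2).
Proof. by []. Qed.
Let bcN (u : baseChange g) : - u = (- u.1, - u.2).
Proof. by []. Qed.
Let bcZ a (u : baseChange g) :
  a *: u = (a`_0 *: u.1, a`_0 *: u.2 + a`_1 *: u.1).
Proof. by []. Qed.

Let brDl x y z : br (x + y) z = br x z + br y z.
Proof. exact: (linD (nlie_linearl nlie z)). Qed.
Let brDr x y z : br z (x + y) = br z x + br z y.
Proof. exact: (linD (nlie_linearr nlie z)). Qed.
Let brZl c x z : br (c *: x) z = c *: br x z.
Proof. exact: (linZ (nlie_linearl nlie z)). Qed.
Let brZr c x z : br z (c *: x) = c *: br z x.
Proof. exact: (linZ (nlie_linearr nlie z)). Qed.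
Let br0l z : br 0 z = 0.
Proof. exact: (lin0 (nlie_linearl nlie z)). Qed.
Let br0r z : br z 0 = 0.
Proof. exact: (lin0 (nlie_linearr nlie z)). Qed.
Let brNr x z : br z (- x) = - br z x.
Proof. exact: (linN (nlie_linearr nlie z)). Qed.
Let brC x y : br x y = - br y x.
Proof. exact: (nlie_antisymmetric nlie). Qed.
Let ND := linD (nlie_linear nlie).
Let N0 := lin0 (nlie_linear nlie).
Let NN := linN (nlie_linear nlie).

(** In this and the following equivalences, the first component of the condition
    on the extension is the same condition on [M] or [br], which holds already;
    arguments without t-part isolate the condition on the first order term. *)
Lemma ext_map_linearP M F : linear M -> linear F <-> linear (ext_map M F).
Proof.
move=> Ml; have MD := linD Ml; have MZ := linZ Ml; have M0 := lin0 Ml.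
split=> [Fl a u v|Fl c x y].
- rewrite !(bcD, bcN, bcZ); congr pair; rewrite /= ?MD ?MZ //.
  by rewrite (linD Fl) (linZ Fl) !scalerDr !addrA (ACl (1*4*2*3*5)).
- have := congr1 snd (Fl (c *: 1) (x, 0) (y, 0)).
  rewrite /= !coefZ !coef_dual1 mulr1 mulr0 !scale0r !scaler0 !addr0.
  by rewrite M0 !add0r.
Qed.

Lemma ext_br_linearlP chi :
  (forall y, linear (chi^~ y)) <-> forall v, linear ((ext_br chi)^~ v).
Proof.
split=> [cl w a u v|cl z c x y].
- rewrite !(bcD, bcN, bcZ); congr pair; rewrite /= ?brDl ?brZl //.
  rewrite (linD (cl _)) (linZ (cl _)) !scalerDr.
  by rewrite !addrA (ACl (1*3*6*4*2*5*7)).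
- have := congr1 snd (cl (z, 0) (c *: 1) (x, 0) (y, 0)).
  rewrite /= !coefZ !coef_dual1 mulr1 mulr0 !scale0r !scaler0 !addr0.
  by rewrite !br0r !br0l !add0r.
Qed.

Lemma ext_br_linearrP chi :
  (forall x, linear (chi x)) <-> forall u, linear (ext_br chi u).
Proof.
split=> [cl w a u v|cl z c x y].
- rewrite !(bcD, bcN, bcZ); congr pair; rewrite /= ?brDr ?brZr //.
  rewrite (linD (cl _)) (linZ (cl _)) !scalerDr.
  by rewrite !addrA (ACl (1*4*6*2*3*5*7)).
- have := congr1 snd (cl (z, 0) (c *: 1) (x, 0) (y, 0)).
  rewrite /= !coefZ !coef_dual1 mulr1 mulr0 !scale0r !scaler0 !addr0.
  by rewrite !br0r !br0l !add0r.
Qed.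

Lemma ext_br_alternatingP chi :
  (forall x, chi x x = 0) <-> forall u, ext_br chi u u = 0.
Proof.
split=> [alt u|alt x].
- congr pair; rewrite /= ?(nlie_alternating nlie) // alt addr0.
  by rewrite [br u.2 _]brC subrr.
- by have := congr1 snd (alt (x, 0)); rewrite /= br0r br0l !add0r.
Qed.

(** The coefficient of t is the sum of three Jacobi identities of g, with the
    t-part taken from one argument at a time, and of the linearization at [br]
    of the Jacobi identity in the direction [chi]. *)
Lemma ext_br_jacobiP chi :
  (forall x y z, br x (chi y z) + br y (chi z x) + br z (chi x y)
     + (chi x (br y z) + chi y (br z x) + chi z (br x y)) = 0) <->
  (forall u v w, ext_br chi u (ext_br chi v w) + ext_br chi v (ext_br chi w u)
     + ext_br chi w (ext_br chi u v) = 0).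
Proof.
split=> [h u v w|h x y z].
- rewrite !(bcD, bcN, bcZ); congr pair; rewrite /= ?(nlie_jacobi nlie) // !brDr.
  (* Jacobi identities with the t-part of w, of v and of u, then the terms in
     chi. *)
  rewrite !addrA (ACl ((1*7*14)*(2*9*11)*(4*6*12)*(3*8*13*(5*10*15)))) /=.
  by rewrite !(nlie_jacobi nlie) !add0r h.
- have := congr1 snd (h (x, 0) (y, 0) (z, 0)).
  rewrite /= !(br0l, br0r, add0r, addr0) => e; rewrite -[RHS]e !addrA.
  by rewrite (ACl (1*4*2*5*3*6)).
Qed.

(** The terms with a t-part of an argument amount to two Nijenhuis identities of
    g, at (u.1, v.2) and at (u.2, v.1). *)
Lemma ext_nijenhuisP chi F :
  (forall x y, br (N x) (F y) + br (F x) (N y) + chi (N x) (N y) =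
     N (br (F x) y + br x (F y) + chi (N x) y + chi x (N y)
        - N (chi x y) - F (br x y)) + F (brN br N x y)) <->
  (forall u v, ext_br chi (ext_map N F u) (ext_map N F v) =
     ext_map N F (ext_br chi (ext_map N F u) v + ext_br chi u (ext_map N F v)
       - ext_map N F (ext_br chi u v))).
Proof.
split=> [h u v|h x y].
- rewrite !(bcD, bcN, bcZ); congr pair; rewrite /= ?(nlie_nijenhuis nlie) //.
  rewrite !brDr !brDl !(nlie_nijenhuis nlie).
  (* Once the t-parts are collected in two values of N, the remaining three
     terms are the left-hand side of h. *)
  rewrite !addrA (ACl (1*3*(2*4*5))) /= h addrA -!ND; congr (N _ + _).
  by rewrite !ND !opprD !addrA (ACl (1*4*7*9*2*8*5*10*3*6*11*12)).
- have := congr1 snd (h (x, 0) (y, 0)).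
  rewrite /= !(br0l, br0r, N0, add0r, addr0) => ->.
  by rewrite opprD !addrA [X in N (X - _ - _)](ACl (1*3*2*4)).
Qed.

(** * Equivalences to first order *)

(** The coefficient of t in (1 + t psi)(N + t F) = (N + t F')(1 + t psi). *)
Lemma ext_map_conjP psi F F' :
  (forall x, F x - F' x = N (psi x) - psi (N x)) <->
  (forall u, ext_map id psi (ext_map N F u) = ext_map N F' (ext_map id psi u)).
Proof.
have eqE x : (F x - F' x = N (psi x) - psi (N x)) <->
    (F x + psi (N x) = N (psi x) + F' x).
  split=> e.
    by rewrite -(subrK (F' x) (F x)) e addrAC subrK.
  apply: (addIr (psi (N x) + F' x)).
  by rewrite addrACA addNr addr0 e addrA subrK.
split=> [h u|h x].
- by congr pair; rewrite /= -addrA ND -addrA; congr (_ + _); apply/eqE.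
- by apply/eqE; have := congr1 snd (h (x, 0)); rewrite /= N0 !add0r.
Qed.

(** The coefficient of t in the condition that 1 + t psi is a morphism from
    [br + t chi] to [br + t chi']. *)
Lemma ext_br_morphP psi chi chi' :
  (forall x y, chi x y - chi' x y =
     br x (psi y) + br (psi x) y - psi (br x y)) <->
  (forall u v, ext_map id psi (ext_br chi u v) =
     ext_br chi' (ext_map id psi u) (ext_map id psi v)).
Proof.
have eqE x y : (chi x y - chi' x y =
       br x (psi y) + br (psi x) y - psi (br x y)) <->
    (chi x y + psi (br x y) = br x (psi y) + br (psi x) y + chi' x y).
  split=> e.
    by rewrite -(subrK (chi' x y) (chi x y)) e addrAC subrK.
  apply: (addIr (psi (br x y) + chi' x y)).
  by rewrite addrACA addNr addr0 addrA subrK.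
split=> [h u v|h x y].
- congr pair; rewrite /= brDr brDl.
  by rewrite -addrA (proj1 (eqE _ _) (h _ _)) !addrA (ACl (1*3*2*4*5)).
- apply/eqE; have := congr1 snd (h (x, 0) (y, 0)).
  by rewrite /= br0r br0l !add0r.
Qed.

(** * Lifts along the augmentation are first order extensions *)

Lemma base_decomp (u : baseChange g) :
  u = (u.1, 0) + 'qX *: ((u.2, 0) : baseChange g).
Proof.
rewrite bcD bcZ !coef_in_dual // !coefX /= scale0r scaler0 addr0 scale1r.
by rewrite !add0r; case: (u).
Qed.

Lemma qX_scale (u : baseChange g) : 'qX *: u = (0, u.1).
Proof. by rewrite bcZ !coef_in_dual // !coefX /= !scale0r scale1r add0r. Qed.

(** By [base_decomp], f u = f (u.1, 0) + t f (u.2, 0), and multiplication by t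
    keeps only the part of f (u.2, 0) that is given by [M]. *)
Lemma ext_mapE (M : g -> g) (f : baseChange g -> baseChange g) :
  linear f -> (forall u, aug_id (f u) = M (aug_id u)) ->
  f = ext_map M (fun x => (f (x, 0)).2).
Proof.
move=> lin aug; apply/funext => u.
rewrite [in LHS](base_decomp u) (linD lin) (linZ lin) qX_scale.
by congr pair; rewrite /= -![(f _).1]/(aug_id _) !aug ?addr0 // addrC.
Qed.

Lemma ext_brE (f : baseChange g -> baseChange g -> baseChange g) :
    (forall v, linear (f^~ v)) -> (forall u, linear (f u)) ->
    (forall u v, aug_id (f u v) = br (aug_id u) (aug_id v)) ->
  f = ext_br (fun x y => (f (x, 0) (y, 0)).2).
Proof.
move=> linl linr aug; apply/funext => u; apply/funext => v.
rewrite [in LHS](base_decomp u) [in LHS](base_decomp v).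
rewrite (linD (linl _)) (linZ (linl _)) !(linD (linr _)) !(linZ (linr _)).
rewrite !qX_scale; congr pair; rewrite /= -![(f _ _).1]/(aug_id _) !aug /=.
  by rewrite !addr0.
by rewrite addr0 -addrA addrC.
Qed.

(** * Deformations and 2-cocycles *)

Implicit Type c : (nary_map g 2 * nary_map g 1)%type.

Definition extension c : deformation_data g :=
  (ext_br (ev2 c.1), ext_map N (ev1 c.2)).

Definition first_order (D : deformation_data g) : precochain g 2 :=
  (fun x : {ffun 'I_2 -> g} => (D.1 (x 0, 0) (x 1, 0)).2,
   fun x : {ffun 'I_1 -> g} => (D.2 (x 0, 0)).2).

Lemma extensionK c : first_order (extension c) = c.
Proof.
case: c => chi F; congr pair; apply/funext => x /=.
  by rewrite br0r br0l !add0r /ev2 args2E.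
by rewrite N0 add0r /ev1 args1E.
Qed.

Lemma first_orderK D : inf_deformation br N D -> extension (first_order D) = D.
Proof.
case: D => mu M [[/= linl linr _ _ linM _] [_ augmu augM]].
rewrite /extension /first_order /= [in RHS](ext_brE linl linr augmu).
rewrite [in RHS](ext_mapE linM augM); congr (ext_br _, ext_map _ _).
  by apply/funext => x; apply/funext => y; rewrite /ev2 !ffunE.
by apply/funext => x; rewrite /ev1 ffunE.
Qed.

(** The six terms of [dCE chi] become the two cyclic sums of
    [ext_br_jacobiP] once [chi] and [br] are known to be antisymmetric. *)
Lemma dCE_eq0P (chi : nary_map g 2) : alternating_multilinear chi ->
  dCE br chi = 0 <->
  (forall x y z, br x (ev2 chi y z) + br y (ev2 chi z x) + br z (ev2 chi x y)
     + (ev2 chi x (br y z) + ev2 chi y (br z x) + ev2 chi z (br x y)) = 0).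
Proof.
move=> /alternating2P[linl linr alt].
have chiC x y : ev2 chi x y = - ev2 chi y x.
  apply/eqP; rewrite -addr_eq0; apply/eqP.
  have := alt (x + y); rewrite (linD (linr _)) !(linD (linl _)) !alt.
  by rewrite add0r addr0 addrC.
have dE x y z : ev3 (dCE br chi) x y z =
    br x (ev2 chi y z) + br y (ev2 chi z x) + br z (ev2 chi x y)
     + (ev2 chi x (br y z) + ev2 chi y (br z x) + ev2 chi z (br x y)).
  rewrite ce_diff2E (chiC x z) brNr opprK -!(chiC _ (br _ _)).
  rewrite (chiC (br x z)) (brC x z) (linN (linr _)) opprK !addrA.
  by rewrite (ACl (1*2*3*6*5*4)).
split=> [d0 x y z|h].
  by rewrite -dE d0.
by apply: ev3_inj => x y z; rewrite dE h.
Qed.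

(** Evaluated at x and y, the cochain on the left is the difference of the two
    sides of the equation on the right. *)
Lemma dN_partialN_eq0P (chi : nary_map g 2) (F : nary_map g 1) :
  dN br N F + (-1) ^+ 2 *: partialN N chi = 0 <->
  (forall x y, br (N x) (ev1 F y) + br (ev1 F x) (N y) + ev2 chi (N x) (N y) =
     N (br (ev1 F x) y + br x (ev1 F y) + ev2 chi (N x) y + ev2 chi x (N y)
        - N (ev2 chi x y) - ev1 F (br x y)) + ev1 F (brN br N x y)).
Proof.
have dE x y : ev2 (dN br N F + (-1) ^+ 2 *: partialN N chi) x y =
     (br (N x) (ev1 F y) + br (ev1 F x) (N y) + ev2 chi (N x) (N y)) -
     (N (br (ev1 F x) y + br x (ev1 F y) + ev2 chi (N x) y + ev2 chi x (N y)
        - N (ev2 chi x y) - ev1 F (br x y)) + ev1 F (brN br N x y)).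
  have -> : ev2 (dN br N F + (-1) ^+ 2 *: partialN N chi) x y =
      ev2 (ce_diff (fun u v => br (N u) v) (brN br N) F) x y
      - N (ev2 (ce_diff br br F) x y) + ev2 (partialN N chi) x y.
    by rewrite -signr_odd scale1r.
  rewrite !ce_diff1E partialN2E -!(brC (ev1 F _)).
  rewrite !(opprD, ND, NN, opprK) !addrA.
  by rewrite (ACl (1*2*7*5*4*9*8*10*6*3)).
split=> [d0 x y|h].
  by apply/eqP; rewrite -subr_eq0 -dE d0.
by apply: ev2_inj => x y; rewrite dE h subrr.
Qed.

Lemma inf_deformation_extensionP c :
  inf_deformation br N (extension c) <-> cocycle br N 2 c.
Proof.
case: c => chi F; split.
- move=> [[/= /ext_br_linearlP linl /ext_br_linearrP linr
           /ext_br_alternatingP alt jac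
           /(ext_map_linearP _ (nlie_linear nlie)) lin /ext_nijenhuisP nij] _].
  have alt2 : alternating_multilinear chi by apply/alternating2P.
  split; first by split=> //; apply/alternating1P.
  congr pair; first by apply/dCE_eq0P => //; apply/ext_br_jacobiP.
  by apply/dN_partialN_eq0P.
- move=> [[/= alt2 /alternating1P lin] [/(dCE_eq0P alt2) jac]].
  move=> /dN_partialN_eq0P nij; have /alternating2P[linl linr alt] := alt2.
  split; last by split.
  split=> /=.
  + exact/ext_br_linearlP.
  + exact/ext_br_linearrP.
  + exact/ext_br_alternatingP.
  + exact/ext_br_jacobiP.
  + exact/(ext_map_linearP _ (nlie_linear nlie)).
  + exact/ext_nijenhuisP.
Qed.

Lemma dNLie1P c c' (f : nary_map g 1) :
  dNLie br N 1 f = c - c' <->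
  (forall x y, ev2 c.1 x y - ev2 c'.1 x y =
     br x (ev1 f y) + br (ev1 f x) y - ev1 f (br x y)) /\
  (forall x, ev1 c.2 x - ev1 c'.2 x = N (ev1 f x) - ev1 f (N x)).
Proof.
have d1E x y : ev2 (dCE br f) x y =
    br x (ev1 f y) + br (ev1 f x) y - ev1 f (br x y).
  by rewrite ce_diff1E -(brC (ev1 f x)).
have d2E x : ev1 (- partialN N f) x = N (ev1 f x) - ev1 f (N x).
  by rewrite -[LHS]/(- ev1 (partialN N f) x) partialN1E opprB.
split=> [e|[e1 e2]].
  split=> [x y|x].
    by rewrite -d1E; have /= -> := congr1 fst e.
  by rewrite -d2E; have /= -> := congr1 snd e.
congr pair.
  by apply: ev2_inj => x y; rewrite d1E -e1.
by apply: ev1_inj => x; rewrite d2E -e2.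
Qed.

(** The 1-cochain that bounds [c - c'] is the first order term psi of the
    equivalence 1 + t psi, whose inverse is 1 - t psi. *)
Lemma equiv_extensionP c c' :
  equiv_deformation (extension c) (extension c') <->
  coboundary br N 2 (c - c').
Proof.
split=> [[phi [_ [lin morph_br morph_N] aug]]|[f /alternating1P lin]].
- have phiE : phi = ext_map id (fun x => (phi (x, 0)).2) by apply: ext_mapE.
  set psi := fun x => (phi (x, 0)).2 in phiE.
  rewrite phiE in lin morph_br morph_N.
  have psiE : ev1 (fun x => psi (x 0)) = psi.
    by apply/funext => x; rewrite /ev1 ffunE.
  exists (fun x => psi (x 0)).
    by apply/alternating1P; rewrite psiE; apply/(ext_map_linearP (M := id)).
  apply/dNLie1P; rewrite psiE; split.
    exact/ext_br_morphP.
  exact/ext_map_conjP.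
- move=> /dNLie1P[hbr hN]; exists (ext_map id (ev1 f)); split=> //.
    by exists (ext_map id (fun x => - ev1 f x)) => u; case: u => x y;
      congr pair; rewrite /= ?addrK ?subrK.
  split; first exact/ext_map_linearP.
    exact/ext_br_morphP.
  exact/ext_map_conjP.
Qed.

Lemma first_order_bij :
  set_bij (inf_deformation br N) (cocycle br N 2) first_order.
Proof.
split=> [D def|D D' /set_mem def /set_mem def' e|c coc].
- by apply/inf_deformation_extensionP; rewrite first_orderK.
- by rewrite -(first_orderK def) e first_orderK.
- exists (extension c); last exact: extensionK.
  exact/inf_deformation_extensionP.
Qed.

Lemma equiv_deformationP D D' :
    inf_deformation br N D -> inf_deformation br N D' ->
  equiv_deformation D D' <->
  coboundary br N 2 (first_order D - first_order D').
Proof.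
by move=> def def'; rewrite -{1}(first_orderK def) -{1}(first_orderK def');
  apply: equiv_extensionP.
Qed.

End Extension.

Theorem theorem4p5 (k : fieldType) (g : lmodType k)
    (br : g -> g -> g) (N : g -> g) (nlie : nijenhuis_lie br N) :
  exists f : set (deformation_data g) -> set (precochain g 2),
    set_bij (deformation_classes br N) (cohomology br N 2) f.
Proof.
exists (image^~ (@first_order k g)); apply: rel_classes_bij.
  exact: first_order_bij.
exact: equiv_deformationP.
Qed.
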